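(* Let $d\ge 1$ and $2\le n_1\le n_2\le\cdots\le n_d$ be integers, and let $G=P_{n_1}\times P_{n_2}\times\cdots\times P_{n_d}$. Then $$\sigma_T(G)= 2\left(\left\lfloor\tfrac{n_1}{2}\right\rfloor+\left\lfloor\tfrac{n_2}{2}\right\rfloor+\cdots+\left\lfloor\tfrac{n_{d-1}}{2}\right\rfloor\right)+1.$$
   Context: $P_n$ is the path on $n$ vertices and $\times$ is the Cartesian product, so $G$ is the $d$-dimensional grid with vertex set $\{(x_1,\dots,x_d): x_i\in\{1,\dots,n_i\}\}$, two vertices adjacent iff they differ by $1$ in exactly one coordinate and agree in all others. For a spanning tree $T$ of a connected graph $G$, $d_T(u,v)$ is the distance between $u$ and $v$ in $T$, $\sigma_T(G,T):=\max_{uv\in E(G)} d_T(u,v)$, and $\sigma_T(G):=\min\{\sigma_T(G,T): T \text{ a spanning tree of } G\}$. An empty sum is $0$. *)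

(* Defs.v *)
From mathcomp Require Import all_boot.
Set Implicit Arguments. Unset Strict Implicit. Unset Printing Implicit Defensive.

Definition has_cycle (T : finType) (t : rel T) : Prop :=
  exists (x : T) (p : seq T),
    [/\ 2 <= size p, uniq (x :: p), path t x p & t (last x p) x].

Definition spanning_tree (T : finType) (e t : rel T) : Prop :=
  [/\ symmetric t,
      subrel t e,
      (forall x y : T, connect t x y)
    & ~ has_cycle t].

Definition walk_len (T : finType) (t : rel T) (u v : T) (k : nat) : bool :=
  [exists p : k.-tuple T, path t u p && (last u p == v)].

(* distance d_t(u,v): length of a shortest walk from u to v in t.
   (Minimum taken over k < #|T|, which contains all shortest-path
   lengths when t is connected; default #|T| otherwise.) *)
Definition dist (T : finType) (t : rel T) (u v : T) : nat :=
  \big[minn/#|T|]_(k < #|T| | walk_len t u v k) k.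

Definition stretch (T : finType) (e t : rel T) : nat :=
  \max_(u : T) \max_(v : T | e u v) dist t u v.

Definition is_tree_stretch (T : finType) (e : rel T) (k : nat) : Prop :=
  (exists t : rel T, spanning_tree e t /\ stretch e t = k) /\
  (forall t : rel T, spanning_tree e t -> k <= stretch e t).

Definition grid_vertex (d : nat) (n : 'I_d -> nat) : finType :=
  {dffun forall i : 'I_d, 'I_(n i)}.

Definition grid_adj (d : nat) (n : 'I_d -> nat) : rel (grid_vertex n) :=
  fun x y =>
    [exists i : 'I_d,
       (((x i).+1 == y i :> nat) || ((y i).+1 == x i :> nat)) &&
       [forall j : 'I_d, (j != i) ==> (x j == y j :> nat)]].

(* Main.v *)
(** Lower bound: send each vertex [u] to the corner [b u] opposite to its
    orthant. A spanning tree has an edge [uv] whose removal leaves [b u] with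
    [v] and [b v] with [u]. These two corners differ at most in the direction
    [j] of [uv], so some grid edge [xy] on the line joining them crosses the
    cut; its tree path uses [uv], and the parts from [x] to [v] and from [u] to
    [y] both have length at least the sum of the [n i / 2] over [i != j].

    Upper bound: keep the edges of direction [i] whose coordinates [j < i] are
    all [n j / 2]; the ends of an edge of direction [i] are joined by centring
    these coordinates, crossing, and moving back. *)

Require Import Defs.
From mathcomp Require Import all_boot.
From mathcomp Require Import zify.

Set Implicit Arguments. Unset Strict Implicit. Unset Printing Implicit Defensive.

(** * Walk lengths and the minimum that defines the distance *)

Section Distance.

Variable T : finType.
Implicit Types (e t : rel T) (u v w : T).

Lemma bigminn_le (I : eqType) (r : seq I) (P : pred I) (F : I -> nat) N k :
  k \in r -> P k -> \big[minn/N]_(i <- r | P i) F i <= F k.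
Proof.
elim: r => // a r IHr; rewrite inE big_cons => /orP[/eqP<-|kr] Pk.
  by rewrite Pk geq_minl.
case: ifP => _; last exact: IHr.
exact: leq_trans (geq_minr _ _) (IHr kr Pk).
Qed.

Lemma walk_lenP t u v k :
  reflect (exists p, [/\ path t u p, last u p = v & size p = k])
          (walk_len t u v k).
Proof.
apply: (iffP existsP) => [[p /andP[tp /eqP lp]]|[p [tp lp sp]]].
  by exists p; rewrite size_tuple.
have sp' : size p == k by apply/eqP.
by exists (Tuple sp') => /=; rewrite tp lp eqxx.
Qed.

Lemma walk_len_cat t u v w k l :
  walk_len t u v k -> walk_len t v w l -> walk_len t u w (k + l).
Proof.
move=> /walk_lenP[p [tp lp sp]] /walk_lenP[q [tq lq sq]].
by apply/walk_lenP; exists (p ++ q); rewrite cat_path tp last_cat lp tq size_cat sp sq.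
Qed.

Lemma walk_len1 t u v : t u v -> walk_len t u v 1.
Proof. by move=> tuv; apply/walk_lenP; exists [:: v]; rewrite /= tuv. Qed.

Lemma walk_len_sym t u v k : symmetric t -> walk_len t u v k -> walk_len t v u k.
Proof.
move=> st /walk_lenP[p [tp lp sp]]; apply/walk_lenP; exists (rev (belast u p)).
rewrite -lp rev_path size_rev size_belast; split=> //.
  by rewrite (eq_path (e' := t)) // => x y; rewrite st.
by case: p {tp lp sp} => //= a p; rewrite rev_cons last_rcons.
Qed.

Lemma walk_len_connect t u v k : walk_len t u v k -> connect t u v.
Proof. by case/walk_lenP=> p [tp lp _]; apply/connectP; exists p. Qed.

Lemma dist_le t u v k : walk_len t u v k -> dist t u v <= k.
Proof.
move=> tk; case: (ltnP k #|T|) => kT.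
  by have := @bigminn_le _ (index_enum 'I_#|T|) (fun i : 'I__ => walk_len t u v i) val #|T| (Ordinal kT) (mem_index_enum _) tk.
(* A longer walk is outside the range of the minimum, but the default value already bounds that
   minimum by [#|T|]. *)
apply: leq_trans kT; rewrite /dist.
by elim/big_ind: _ => // [x y xT _|i _]; [exact: leq_trans (geq_minl _ _) xT | exact: ltnW].
Qed.

Lemma le_dist t u v k : connect t u v ->
  (forall l, walk_len t u v l -> k <= l) -> k <= dist t u v.
Proof.
move=> /connectP[p tp lp] tk.
(* This handles the default value: a walk without repeated vertices has fewer than [#|T|] steps. *)
have kT : k <= #|T|.
  case/shortenP: tp lp => q tq uq _ lq.
  apply: leq_trans (_ : size q <= _); first by apply: tk; apply/walk_lenP; exists q.
  by apply: ltnW; rewrite -[_.+1]/(size (u :: q)) -(card_uniqP uq) max_card.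
rewrite /dist; elim/big_ind: _ => // [x y kx ky|i]; last exact: tk.
by rewrite leq_min kx.
Qed.

Lemma dist_le_stretch e t u v : e u v -> dist t u v <= stretch e t.
Proof.
move=> euv; apply: leq_trans (leq_bigmax (F := fun u => \max_(v | e u v) _) u).
exact: (leq_bigmax_cond (F := fun v => dist t u v)).
Qed.

Lemma stretch_le e t k :
  (forall u v, e u v -> dist t u v <= k) -> stretch e t <= k.
Proof. by move=> H; apply/bigmax_leqP=> u _; apply/bigmax_leqP=> v; apply: H. Qed.

End Distance.

(** * Cutting a tree at an edge *)

Section Bridges.

Variables (T : finType) (t : rel T).
Hypotheses (t_sym : symmetric t) (t_irr : irreflexive t).
Hypotheses (t_conn : forall x y, connect t x y) (t_acyclic : ~ has_cycle t).

Definition del_edge u v : rel T :=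
  fun x y => t x y && ~~ ((x == u) && (y == v) || (x == v) && (y == u)).

Definition side u v : {set T} := [set x | connect (del_edge u v) v x].

Lemma del_edge_sym u v : symmetric (del_edge u v).
Proof.
move=> x y; rewrite /del_edge t_sym; congr (_ && ~~ _).
by rewrite orbC [(x == v) && _]andbC [(x == u) && _]andbC.
Qed.

Lemma del_edgeC u v : del_edge u v =2 del_edge v u.
Proof. by move=> x y; rewrite /del_edge orbC. Qed.

(** A simple path from [v] to [u] avoiding the edge [uv] would close up with it to a cycle. *)
Lemma bridge u v : t u v -> u \notin side u v.
Proof.
move=> tuv; rewrite inE; apply/negP=> /connectP[p dp].
case/shortenP: dp => q dq uq _ lq.
have tq : path t v q by apply: sub_path dq => x y /andP[].
apply: t_acyclic; exists v, q; split=> //; last by rewrite -lq.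
(* A cycle needs two further vertices: an empty path would make [uv] a loop, and a path of one step
   would be the deleted edge itself. *)
case: q dq uq tq lq => [|a [|b q]] //= dq _ _ lq.
  by move: tuv; rewrite lq t_irr.
by move: dq; rewrite /del_edge -lq !eqxx /= !orbT andbF.
Qed.

Lemma side_self u v : v \in side u v.
Proof. by rewrite inE connect0. Qed.

Lemma path_del_edge u v x (p : seq T) z :
  (z == u) || (z == v) -> z \notin x :: p -> path t x p -> path (del_edge u v) x p.
Proof.
move=> zuv; elim: p x => //= y p IHp x; rewrite !inE !negb_or.
move=> /and3P[zx zy zp] /andP[txy typ]; rewrite IHp ?inE ?negb_or ?zy // andbT.
rewrite /del_edge txy /=; case/orP: zuv zx zy => /eqP-> /negPf ux /negPf uy.
  by rewrite [x == u]eq_sym [y == u]eq_sym ux uy andbF.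
by rewrite [x == v]eq_sym [y == v]eq_sym ux uy andbF.
Qed.

(** Take for [w] the second vertex of a simple path from [v] to [x]; the rest of the path never
    returns to [v], so it survives the deletion of [vw]. *)
Lemma side_step v x : v != x -> exists2 w, t v w & x \in side v w.
Proof.
move=> vx; have /connectP[p tp] := t_conn v x.
case/shortenP: tp => q tq uq _ lq.
case: q tq uq lq => [|w q] /=; first by move=> _ _ xv; rewrite xv eqxx in vx.
move=> /andP[tvw tq] /andP[vq _] lq; exists w => //.
rewrite inE; apply/connectP; exists q => //.
by apply: (path_del_edge (z := v)) => //; rewrite eqxx.
Qed.

Lemma side_disjoint u v x : t u v -> x \in side v u -> x \notin side u v.
Proof.
move=> tuv; rewrite !inE (eq_connect (del_edgeC v u)) => ux.
apply/negP=> vx; case/negP: (bridge tuv); rewrite inE.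
apply: connect_trans vx _.
by rewrite (sym_connect_sym (del_edge_sym u v)).
Qed.

(** A path from [w] that avoids the edge [vw] cannot meet [v], hence avoids [uv] too, while [vw]
    itself joins it to [v]. Strictness is witnessed by [v]. *)
Lemma side_proper u v w : t u v -> t v w -> w != u -> side v w \proper side u v.
Proof.
move=> tuv tvw wu; apply/properP; split; last first.
  by exists v; [exact: side_self | exact: bridge].
apply/subsetP=> x; rewrite inE => /connectP[p dp lp].
rewrite inE; apply: (@connect_trans _ _ w).
  apply: connect1; rewrite /del_edge tvw (negPf wu) andbF orbF /= negb_and.
  by apply/orP; left; apply/eqP=> vu; rewrite vu t_irr in tuv.
have vp : v \notin w :: p.
  apply/negP=> /splitPl pv; case: pv dp lp => p1 p2 l1; rewrite cat_path => /andP[d1 _] _.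
  move: (bridge tvw); rewrite inE => /negP; apply.
  by apply/connectP; exists p1.
apply/connectP; exists p => //; apply: (path_del_edge (z := v)) => //.
  by rewrite eqxx orbT.
by apply: sub_path dp => a b /andP[].
Qed.

Lemma side_step_out u v x y : t x y -> x \in side u v -> y \notin side u v ->
  x = v /\ y = u.
Proof.
move=> txy; rewrite !inE => cx cy.
have : ~~ del_edge u v x y.
  by apply/negP=> dxy; case/negP: cy; apply: connect_trans cx (connect1 dxy).
rewrite /del_edge txy negbK /= => /orP[]/andP[/eqP xE /eqP yE] //.
by case/negP: cy; rewrite yE connect0.
Qed.

(** The walk is split where it first leaves the side, which can only happen along the edge from [v]
    to [u]. *)
Lemma walk_len_cross u v x y l :
  walk_len t x y l -> x \in side u v -> y \notin side u v ->
  exists k m, [/\ walk_len t x v k, walk_len t u y m & l = k + 1 + m].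
Proof.
move=> /walk_lenP[p [+ + <-]]; elim: p x {l} => [|z p IHp] x /=.
  by move=> _ -> ->.
move=> /andP[txz tp] lp xs ys; case zs: (z \in side u v).
  have [k [m [wk wm sp]]] := IHp z tp lp zs ys.
  exists (1 + k), m; split=> //; last by lia.
  exact: walk_len_cat (walk_len1 txz) wk.
have [xv zu] := side_step_out txz xs (negbT zs); exists 0, (size p); split=> //.
  by apply/walk_lenP; exists [::].
by apply/walk_lenP; exists p; rewrite -zu.
Qed.

(* Among the edges [uv] for which [b u] is on the side of [v], one with the
   smallest such side works: otherwise the step from [v] towards [b v] gives a
   smaller side. *)
Lemma mutually_facing_edge (b : T -> T) (x0 : T) : (forall x, b x != x) ->
  exists u v, [/\ t u v, b u \in side u v & b v \notin side u v].
Proof.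
move=> bx.
have [v0 tv0 bv0] : exists2 w, t x0 w & b x0 \in side x0 w.
  by apply: side_step; rewrite eq_sym.
move: {2}(#|_|) (leqnn #|side x0 v0|) => m.
elim: m x0 v0 tv0 bv0 => [|m IHm] u v tuv bu.
  by rewrite leqn0 cards_eq0 => /eqP s0; rewrite s0 inE in bu.
move=> le_m; case bv: (b v \in side u v); last by exists u, v; rewrite bv.
have [w tvw bw] : exists2 w, t v w & b v \in side v w.
  by apply: side_step; rewrite eq_sym.
have wu : w != u.
  apply: contraL bv => /eqP wu; rewrite -wu in tuv *.
  by apply: side_disjoint => //; rewrite wu.
exact: (IHm v w) (leq_trans (proper_card (side_proper tuv tvw wu)) le_m).
Qed.

End Bridges.

(** * An acyclicity criterion by a height function *)

Section HeightAcyclic.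

Variables (T : finType) (t : rel T) (h : T -> nat).
Hypothesis t_sym : symmetric t.
Hypothesis h_neq : forall x y, t x y -> h x != h y.
Hypothesis down_uniq : forall x y z,
  t x y -> t x z -> h y < h x -> h z < h x -> y = z.

(* The two neighbours on a cycle of a vertex of maximal height both lie below
   it. *)
Lemma height_acyclic : ~ has_cycle t.
Proof.
move=> [x [p [sp up tp tl]]].
have cyc : cycle t (x :: p) by rewrite /= rcons_path tp.
have [z zp zmax] : exists2 z, z \in x :: p & forall y, y \in x :: p -> h y <= h z.
  have xp : x \in x :: p by rewrite inE eqxx.
  case: (@arg_maxnP T x (mem (x :: p)) h xp) => z zp zmax.
  by exists z => // y /zmax.
case: (rot_to zp) => i s rE.
have us : uniq (z :: s) by rewrite -rE rot_uniq.
have cs : cycle t (z :: s) by rewrite -rE rot_cycle.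
have ss : 2 <= size s by have := congr1 size rE; rewrite size_rot /= => -[<-].
have zmax' y : y \in s -> h y <= h z.
  by move=> ys; apply: zmax; rewrite -(mem_rot i) rE inE ys orbT.
case/lastP: s ss us cs zmax' {rE} => // s b; case: s => // a s _.
rewrite [cycle _ _]/= rcons_path last_rcons => us /and3P[tza _ tbz] zmax'.
have below y : t z y -> y \in rcons (a :: s) b -> h y < h z.
  by move=> tzy ys; rewrite ltn_neqAle zmax' // eq_sym h_neq.
have ab : a = b.
  apply: (@down_uniq z) => //; first by rewrite t_sym.
    by apply: below => //; rewrite mem_rcons !inE eqxx orbT.
  by apply: below; rewrite 1?t_sym // mem_rcons !inE eqxx.
by move: us; rewrite ab /= mem_rcons inE eqxx /= andbF.
Qed.

End HeightAcyclic.

(** * Coordinates, steps and distances in the grid *)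

Section Grid.

Variables (d : nat) (n : 'I_d -> nat).
Hypothesis n_ge2 : forall i, 2 <= n i.
Local Notation V := (grid_vertex n).
Implicit Types (x y z : V) (i j : 'I_d).

Definition step i x y :=
  (((x i).+1 == y i :> nat) || ((y i).+1 == x i :> nat)) &&
  [forall j : 'I_d, (j != i) ==> (x j == y j :> nat)].

Lemma stepP i x y :
  reflect ((((x i).+1 = y i :> nat) \/ ((y i).+1 = x i :> nat)) /\
           forall j, j != i -> x j = y j :> nat)
          (step i x y).
Proof.
apply: (iffP andP) => -[xi xj]; split.
- by case/orP: xi => /eqP; [left|right].
- by move=> j ji; have /forallP/(_ j) := xj; rewrite ji => /eqP.
- by apply/orP; case: xi => /eqP; [left|right].
- by apply/forallP=> j; apply/implyP=> /xj->.
Qed.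

Lemma step_sym i x y : step i x y = step i y x.
Proof.
by apply/stepP/stepP=> -[xi xj]; split=> [|j /xj//]; lia.
Qed.

Lemma grid_eqP x y : (forall i, x i = y i :> nat) -> x = y.
Proof. by move=> xy; apply/ffunP=> i; apply/val_inj/xy. Qed.

Lemma n_gt0 i : 0 < n i.
Proof. exact: ltnW. Qed.

(** Reducing modulo [n i] turns any function into a vertex without bounds to supply; [mkvE] recovers
    the value when it is in range. *)
Definition mkv (g : 'I_d -> nat) : V := [ffun i => Ordinal (ltn_pmod (g i) (n_gt0 i))].

Lemma mkvE g i : g i < n i -> mkv g i = g i :> nat.
Proof. by move=> gi; rewrite ffunE /= modn_small. Qed.

Definition upd i (k : nat) x : V := mkv (fun j => if j == i then k else x j).

Lemma upd_same i k x : k < n i -> upd i k x i = k :> nat.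
Proof. by move=> kn; rewrite mkvE eqxx. Qed.

Lemma upd_other i k x j : j != i -> upd i k x j = x j :> nat.
Proof. by move=> ji; rewrite mkvE (negPf ji). Qed.

Definition absdiff (a b : nat) := (a - b) + (b - a).

Definition grid_dist x y := \sum_i absdiff (x i) (y i).

(** The common remainder [r] collects the coordinates other than [i]. The generality in [P] and [f]
    covers the grid distance, the height and sums over initial coordinates. *)
Lemma step_dist i x y (P : pred 'I_d) (f : 'I_d -> nat) : step i x y -> P i ->
  exists r, \sum_(j | P j) absdiff (x j) (f j) = absdiff (x i) (f i) + r /\
            \sum_(j | P j) absdiff (y j) (f j) = absdiff (y i) (f i) + r.
Proof.
move=> /stepP[_ xj] Pi; exists (\sum_(j | P j && (j != i)) absdiff (x j) (f j)).
split; rewrite [LHS](bigD1 i) //=; congr (_ + _).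
by apply: eq_bigr => j /andP[_ /xj->].
Qed.

Lemma walk_grid_dist x y k : walk_len (@grid_adj d n) x y k -> grid_dist x y <= k.
Proof.
move=> /walk_lenP[p [+ + <-]]; elim: p x {k} => [|z p IHp] x /=.
  by move=> _ <-; rewrite /grid_dist big1 // => i _; rewrite /absdiff subnn.
move=> /andP[/existsP[i xz] zp] lp; have := IHp z zp lp.
have [r [+ +]] := @step_dist i x z predT (fun j => y j) xz isT.
rewrite -/(grid_dist x y) -/(grid_dist z y) => -> ->.
have /stepP[+ _] := xz; rewrite /absdiff /=; lia.
Qed.

(** * Opposite corners and the lower bound *)

Definition opposite_corner x : V :=
  mkv (fun i => if x i < (n i)./2 then (n i).-1 else 0).

Lemma opposite_cornerE x i :
  opposite_corner x i = (if x i < (n i)./2 then (n i).-1 else 0) :> nat.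
Proof. by rewrite mkvE //; case: ifP => _; have := n_gt0 i; lia. Qed.

Lemma opposite_corner_far x i : (n i)./2 <= absdiff (opposite_corner x i) (x i).
Proof.
rewrite opposite_cornerE /absdiff; have := ltn_ord (x i); have := n_ge2 i.
case: ifP; lia.
Qed.

Lemma opposite_corner_neq x i : opposite_corner x != x.
Proof.
apply/eqP=> xx; have := opposite_corner_far x i; rewrite xx /absdiff.
have := n_ge2 i; lia.
Qed.

Lemma opposite_corner_step i x y j : step i x y -> j != i ->
  opposite_corner x j = opposite_corner y j :> nat.
Proof. by move=> /stepP[_ xj] /xj; rewrite !opposite_cornerE => ->. Qed.

(** A discrete intermediate value principle, used below along a grid line. *)
Lemma nat_cross (S : pred nat) a b : S a != S b ->
  exists2 k, minn a b <= k < maxn a b & S k != S k.+1.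
Proof.
wlog ab : a b / a <= b => [H|].
  by case/orP: (leq_total a b) => [/H//|/H{}H]; rewrite eq_sym minnC maxnC.
rewrite (minn_idPl ab) (maxn_idPr ab).
elim: b ab => [|b IHb]; first by rewrite leqn0 => /eqP->; rewrite eqxx.
rewrite leq_eqVlt => /orP[/eqP->|ab]; first by rewrite eqxx.
case: (eqVneq (S b) (S b.+1)) => [<- /IHb[//|k kab Sk]|Sb _]; last first.
  by exists b => //; lia.
by exists k => //; lia.
Qed.

Lemma line_cross (S : {set V}) i x y : (forall j, j != i -> x j = y j :> nat) ->
  x \in S -> y \notin S ->
  exists z w, [/\ step i z w, z \in S, w \notin S &
    forall j, j != i -> z j = x j :> nat /\ w j = x j :> nat].
Proof.
move=> xy xS yS.
have xE : upd i (x i) x = x.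
  apply: grid_eqP => j; case: (eqVneq j i) => [->|ji]; last exact: upd_other.
  exact: upd_same.
have yE : upd i (y i) x = y.
  apply: grid_eqP => j; case: (eqVneq j i) => [->|ji]; first exact: upd_same.
  by rewrite upd_other // xy.
have := @nat_cross (fun k => upd i k x \in S) (x i) (y i).
rewrite xE yE xS (negPf yS) => /(_ isT)[k kxy].
have kn : k.+1 < n i by have := ltn_ord (x i); have := ltn_ord (y i); lia.
have st : step i (upd i k x) (upd i k.+1 x).
  apply/stepP; split=> [|j ji]; last by rewrite !upd_other.
  by left; rewrite !upd_same // ltnW.
(* The crossing may enter or leave [S] as the coordinate grows; in either case the end in [S] is
   named first. *)
case zS: (upd i k x \in S); case wS: (upd i k.+1 x \in S) => // _.
  by exists (upd i k x), (upd i k.+1 x); rewrite zS wS; split=> // j ji; rewrite !upd_other.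
exists (upd i k.+1 x), (upd i k x); rewrite zS wS step_sym.
by split=> // j ji; rewrite !upd_other.
Qed.

Lemma grid_adj_irr : irreflexive (@grid_adj d n).
Proof.
by move=> x; apply/negbTE/negP=> /existsP[i /stepP[+ _]]; lia.
Qed.

(** The direction [j] is that of the mutually facing edge, so it depends on [t]; [i0] witnesses that
    the dimension is positive, which makes every vertex differ from its opposite corner. *)
Lemma stretch_lower (t : rel V) (i0 : 'I_d) : spanning_tree (@grid_adj d n) t ->
  exists j, 2 * (\sum_(i | i != j) (n i)./2) + 1 <= stretch (@grid_adj d n) t.
Proof.
move=> [t_sym t_sub t_conn t_acyc].
have t_irr : irreflexive t.
  by move=> x; apply/negbTE/negP=> /t_sub; rewrite grid_adj_irr.
have [u [v [tuv bu bv]]] := mutually_facing_edge t_sym t_irr t_conn t_acyc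
  (mkv (fun=> 0)) (fun x => opposite_corner_neq x i0).
have /existsP[j uvj] := t_sub _ _ tuv; exists j.
have [x [y [xy xS yS E]]] :=
  line_cross (fun i => @opposite_corner_step j u v i uvj) bu bv.
apply: leq_trans (dist_le_stretch t (_ : grid_adj x y)); last by apply/existsP; exists j.
apply: le_dist (t_conn _ _) _ => l /walk_len_cross/(_ xS yS)[k [m [wk wm ->]]].
have sub a b q : walk_len t a b q -> grid_dist a b <= q.
  case/walk_lenP=> p [tp lp sp]; apply: walk_grid_dist; apply/walk_lenP.
  by exists p; split=> //; apply: sub_path tp.
have far (a b : V) : (forall i, i != j -> (n i)./2 <= absdiff (a i) (b i)) ->
    \sum_(i | i != j) (n i)./2 <= grid_dist a b.
  move=> ab; rewrite /grid_dist [leqRHS](bigID (fun i => i != j)) /=.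
  by apply: leq_trans (leq_addr _ _); apply: leq_sum.
(* Off direction [j], the vertices [x] and [y] and both opposite corners agree, so [x] is as far
   from [v] as the corner opposite to [v]. *)
have xv : \sum_(i | i != j) (n i)./2 <= grid_dist x v.
  apply: far => i ij; rewrite (E i ij).1 (opposite_corner_step uvj ij).
  exact: opposite_corner_far.
have uy : \sum_(i | i != j) (n i)./2 <= grid_dist u y.
  apply: far => i ij; rewrite (E i ij).2 /absdiff addnC.
  exact: opposite_corner_far.
have := sub _ _ _ wk; have := sub _ _ _ wm; lia.
Qed.

(** * The comb tree and the upper bound *)

Local Notation c i := (n i)./2.

Definition comb : rel V := fun x y =>
  [exists i, step i x y && [forall j : 'I_d, (j < i) ==> (x j == c j :> nat)]].

Lemma combP x y :
  reflect (exists i, step i x y /\ forall j : 'I_d, j < i -> x j = c j :> nat)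
          (comb x y).
Proof.
apply: (iffP existsP) => -[i].
  case/andP=> xy /forallP H; exists i; split=> // j ji.
  by have := H j; rewrite ji => /eqP.
case=> xy H; exists i; rewrite xy; apply/forallP=> j; apply/implyP=> /H->.
exact: eqxx.
Qed.

Lemma comb_sym : symmetric comb.
Proof.
suff H x y : comb x y -> comb y x by move=> x y; apply/idP/idP; apply: H.
move=> /combP[i [xy H]]; apply/combP; exists i; split; first by rewrite step_sym.
move=> j ji; rewrite -(H j ji); have /stepP[_ ->//] := xy.
by apply/eqP=> jE; rewrite jE ltnn in ji.
Qed.

(** This is the grid distance to the central vertex, which acts as the root of the comb. *)
Definition height x := \sum_i absdiff (x i) (c i).

Lemma step_height i x y : step i x y ->
  height x != height y /\
  (height y < height x -> absdiff (y i) (c i) < absdiff (x i) (c i)).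
Proof.
move=> xy; have [r [+ +]] := @step_dist i x y predT (fun j => c j) xy isT.
rewrite -/(height x) -/(height y) => -> ->.
have /stepP[+ _] := xy; rewrite /absdiff /=; lia.
Qed.

Lemma towards_unique a b b' m : a.+1 = b \/ b.+1 = a -> a.+1 = b' \/ b'.+1 = a ->
  absdiff b m < absdiff a m -> absdiff b' m < absdiff a m -> b = b'.
Proof. rewrite /absdiff; lia. Qed.

(** A descending edge at [x] must move the first coordinate that is off centre, and move it towards
    the centre, so its lower end is determined. *)
Lemma comb_acyclic : ~ has_cycle comb.
Proof.
apply: (@height_acyclic _ _ height); first exact: comb_sym.
  by move=> x y /combP[i [/step_height[]]].
move=> x y z /combP[i [xy Hi]] /combP[j [xz Hj]].
move=> /(step_height xy).2 yx /(step_height xz).2 zx.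
have ij : i = j.
  (* If the directions differed, the smaller one would be already centred at [x], and moving along
     it could not descend. *)
  case: (ltngtP i j) => [/Hj xi|/Hi xj|/ord_inj//].
    by move: yx; rewrite xi /absdiff subnn.
  by move: zx; rewrite xj /absdiff subnn.
rewrite -{}ij in xz zx; apply: grid_eqP => k.
have /stepP[xyi xyk] := xy; have /stepP[xzi xzk] := xz.
case: (eqVneq k i) => [->|ki]; last by rewrite -xyk // -xzk.
exact: (towards_unique xyi xzi yx zx).
Qed.

Definition center_below (m : nat) x : V := mkv (fun j => if j < m then c j else x j).

Lemma half_lt i : c i < n i.
Proof. by have := n_ge2 i; lia. Qed.

Lemma center_belowE m x j : center_below m x j = (if j < m then c j else x j) :> nat.
Proof. by rewrite mkvE //; case: ifP => // _; apply: half_lt. Qed.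

(** Coordinates are centred in increasing order of index, one unit at a time, so that each step is
    an edge of the comb. *)
Lemma walk_center_below (m : nat) x :
  walk_len comb x (center_below m x) (\sum_(j < d | j < m) absdiff (x j) (c j)).
Proof.
move sE: (\sum_(j < d | _) _) => s; elim: s x sE => [|s IHs] x sE.
  apply/walk_lenP; exists [::]; split=> //=; apply/grid_eqP=> j.
  rewrite center_belowE; case: ifP => // jm.
  move/eqP: sE; rewrite sum_nat_eq0 => /forallP/(_ j); rewrite jm /= /absdiff; lia.
have [i0 i0m] : exists i : 'I_d, (i < m) && (x i != c i :> nat).
  apply/existsP; apply: contraTT isT; rewrite negb_exists => /forallP H.
  suff : s.+1 = 0 by [].
  rewrite -sE big1 // => j jm; move: (H j); rewrite jm /absdiff; lia.
case: (@arg_minnP _ i0 (fun i : 'I_d => (i < m) && (x i != c i :> nat)) val i0m).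
(* Minimality of [i] says that all smaller coordinates are centred, exactly what an edge of
   direction [i] requires. *)
move=> i /andP[im xi] imin.
pose y := upd i (if x i < c i then (x i).+1 else (x i).-1) x.
have yi : y i = (if x i < c i then (x i).+1 else (x i).-1) :> nat.
  rewrite upd_same //; have := half_lt i; have := ltn_ord (x i).
  by case: ifP; lia.
have xy : step i x y.
  apply/stepP; split=> [|j ji]; last by rewrite upd_other.
  by rewrite yi; case: ifP; lia.
have cxy : comb x y.
  apply/combP; exists i; split=> // j ji; apply/eqP/negPn/negP=> xj.
  by have := imin j; rewrite (ltn_trans ji im) xj leqNgt ji => /(_ isT).
have sy : \sum_(j < d | j < m) absdiff (y j) (c j) = s.
  have [r [xr ->]] := @step_dist i x y (fun j => j < m) (fun j => c j) xy im.
  by move: sE; rewrite {}xr yi /absdiff; case: ifP; lia.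
have -> : center_below m x = center_below m y.
  apply: grid_eqP => j; rewrite !center_belowE; case: ifP => // jm.
  by rewrite upd_other //; apply: contraFneq jm => ->.
exact: walk_len_cat (walk_len1 cxy) (IHs y sy).
Qed.

Lemma comb_connected x y : connect comb x y.
Proof.
(* With bound [d] every coordinate is centred, so both walks end at the root. *)
have cE : center_below d x = center_below d y.
  by apply: grid_eqP => i; rewrite !center_belowE ltn_ord.
apply: connect_trans (walk_len_connect (walk_center_below d x)) _.
rewrite cE (sym_connect_sym comb_sym).
exact: walk_len_connect (walk_center_below d y).
Qed.

Lemma comb_spanning_tree : spanning_tree (@grid_adj d n) comb.
Proof.
split; [exact: comb_sym | | exact: comb_connected | exact: comb_acyclic].
by move=> x y /combP[i [xy _]]; apply/existsP; exists i.
Qed.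

Lemma stretch_comb : stretch (@grid_adj d n) comb <=
  2 * (\sum_(i < d | i < d.-1) c i) + 1.
Proof.
apply: stretch_le => x y /existsP[i xy].
(* Each coordinate is within [c j] of the centre, and [j < i] excludes the last direction. *)
have le_c z : \sum_(j < d | j < i) absdiff (z j) (c j) <= \sum_(j < d | j < d.-1) c j.
  rewrite [leqLHS]big_mkcond [leqRHS]big_mkcond; apply: leq_sum => j _.
  have := ltn_ord (z j); have := ltn_ord i; rewrite /absdiff.
  by case: ifP; case: ifP; lia.
have cxy : comb (center_below i x) (center_below i y).
  apply/combP; exists i; split=> [|j ji]; last by rewrite center_belowE ji.
  have /stepP[xyi xyj] := xy.
  apply/stepP; rewrite !center_belowE ltnn; split=> // j ji.
  by rewrite !center_belowE; case: ifP => // _; apply: xyj.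
have := walk_len_cat (walk_len_cat (walk_center_below i x) (walk_len1 cxy))
  (walk_len_sym comb_sym (walk_center_below i y)).
move/dist_le => /leq_trans; apply.
by have := le_c x; have := le_c y; lia.
Qed.

End Grid.

Theorem theorem4p2 (d : nat) (n : 'I_d -> nat) :
  1 <= d ->
  (forall i : 'I_d, 2 <= n i) ->
  (forall i j : 'I_d, i <= j -> n i <= n j) ->
  is_tree_stretch (@grid_adj d n)
    (2 * (\sum_(i < d | i < d.-1) (n i)./2) + 1).
Proof.
case: d n => // d n _ n_ge2 n_mono.
have lower t : spanning_tree (@grid_adj d.+1 n) t ->
    2 * (\sum_(i < d.+1 | i < d) (n i)./2) + 1 <= stretch (@grid_adj d.+1 n) t.
  move=> /(stretch_lower n_ge2 ord0)[j]; apply: leq_trans.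
  rewrite leq_add2r leq_mul2l /=.
  have nj := n_mono j ord_max (leq_ord j).
  (* Both sides are the full sum, so comparing the two partial sums amounts to comparing the omitted
     terms; by monotonicity the last one is largest. *)
  have E : \sum_(i < d.+1 | i != j) (n i)./2 + (n j)./2 =
           \sum_(i < d.+1 | i < d) (n i)./2 + (n ord_max)./2.
    have <- : \sum_(i < d.+1) (n i)./2 = \sum_(i < d.+1 | i != j) (n i)./2 + (n j)./2.
      by rewrite (bigD1 j) //= addnC.
    rewrite (bigD1 ord_max) //= addnC; congr (_ + _); apply: eq_bigl => i.
    by rewrite -val_eqE /= ltn_neqAle leq_ord andbT.
  by rewrite -(leq_add2r (n ord_max)./2) -E leq_add2l half_leq.
split=> //; exists (comb (n := n)); split; first exact: comb_spanning_tree.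
by apply/eqP; rewrite eqn_leq stretch_comb //= lower //; apply: comb_spanning_tree.
Qed.
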